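(* Let $q,d\geq2$ and $\iota\geq1$ be integers and let $1>x>1-\frac{2}{(d+1)\iota}$. Write $\xi=x-\left(1-\frac{2}{(d+1)\iota}\right)$ and let $\delta>0$. Let $G=(V,E)$ be a graph and $\mathcal{C}$ an even generating set of $\mathcal{F}_q(G)$ of size $r$ satisfying $d(\mathcal{C})\leq d$ and $\iota(\mathcal{C})\leq \iota$. Then the $\delta$-mixing time of the flow Markov chain for $(G,\mathcal{C})$ with parameter $x$ is at most $\frac{4r}{d\iota}\log(r \delta^{-1})\xi^{-1}$.
   Context: Graphs are finite multigraphs with a fixed orientation. $\mathcal{F}_q(G)$ is the set of $\mathbb{Z}_q$-flows $f:E\to\mathbb{Z}_q$ (inflow equals outflow in $\mathbb{Z}_q$ at every vertex); $\supp(f)=\{e:f(e)\ne0\}$. For an even subgraph $C$, choose an Eulerian orientation of each component and let $\chi_C(e)=0$ for $e\notin C$, $\chi_C(e)=\pm1$ for $e\in C$ according to agreement with $G$'s orientation. An even generating set of $\mathcal{F}_q(G)$ is a set $\mathcal{C}$ of even subgraphs whose $\chi_C$ (mod $q$) generate $\mathcal{F}_q(G)$ as a $\mathbb{Z}_q$-module. $d(\mathcal{C})=\max_C|\{D\in\mathcal{C}\setminus\{C\}:C\cap D\neq\emptyset\}|$, $\iota(\mathcal{C})=\max_{C_1\ne C_2}|C_1\cap C_2|$. $\mu_{\mathrm{flow}}(f)=x^{|\supp(f)|}/\sum_{g\in\mathcal{F}_q(G)}x^{|\supp(g)|}$. The flow Markov chain on $\mathcal{F}_q(G)$ has transitions,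 for $f\in\mathcal{F}_q(G)$, $t\in\mathbb{Z}_q\setminus\{0\}$, $C\in\mathcal{C}$: $P(f,f+t\chi_C)=\frac1r\frac{\mu_{\mathrm{flow}}(f+t\chi_C)}{\sum_{u\in\mathbb{Z}_q}\mu_{\mathrm{flow}}(f+u\chi_C)}$, $P(f,f)=\frac1r\sum_{C\in\mathcal{C}}\frac{\mu_{\mathrm{flow}}(f)}{\sum_{u\in\mathbb{Z}_q}\mu_{\mathrm{flow}}(f+u\chi_C)}$, all others zero (i.e., choose $C$ uniformly and resample its coefficient proportional to $\mu_{\mathrm{flow}}$); its stationary distribution is $\mu_{\mathrm{flow}}$. The $\delta$-mixing time is the smallest $t$ such that the distribution after $t$ steps is within total variation distance $\delta$ of the stationary distribution (from any start).
   Formalization: The stated bound T fails in degenerate cases (δ>r makes T negative; r=1 with δ near 1 fails by integer rounding; r=0 leaves log undefined), so it is proved when δ≤r and (r≥2 or δ≤1/2), and in all cases the mixing time is shown to be at most max(1,T). *)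

(* Defs.v *)
From mathcomp Require Import all_boot all_order all_algebra.
From mathcomp Require Import reals exp.

Set Implicit Arguments.
Unset Strict Implicit.
Unset Printing Implicit Defensive.

Import Order.TTheory GRing.Theory Num.Theory.
Local Open Scope ring_scope.

(* Loops and parallel edges are allowed; the fixed orientation of an edge is
   from [tail] to [head]. *)
Record multigraph := Multigraph {
  vertex : finType;
  edge : finType;
  tail : edge -> vertex;
  head : edge -> vertex }.

Definition is_flow (G : multigraph) (q : nat) (f : {ffun edge G -> 'Z_q}) : bool :=
  [forall v, \sum_(e | head e == v) f e == \sum_(e | tail e == v) f e].

Definition flow (G : multigraph) (q : nat) : Type :=
  {f : {ffun edge G -> 'Z_q} | is_flow f}.

Definition supp (G : multigraph) (q : nat) (f : {ffun edge G -> 'Z_q}) :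
    {set edge G} :=
  [set e | f e != 0].

(* Subgraphs are identified with their edge sets; a loop counts twice in the
   degree of its vertex. *)
Definition subdeg (G : multigraph) (C : {set edge G}) (v : vertex G) : nat :=
  (#|[set e in C | tail e == v]| + #|[set e in C | head e == v]|)%N.

Definition even_subgraph (G : multigraph) (C : {set edge G}) : Prop :=
  forall v, ~~ odd (subdeg C v).

(* An orientation of C is encoded by o : edge G -> bool, where [o e] says
   whether the orientation of e agrees with that of G; the values of o outside
   C are irrelevant. *)
Definition eulerian_orientation (G : multigraph) (C : {set edge G})
    (o : edge G -> bool) : Prop :=
  forall v,
    #|[set e in C | (if o e then head e else tail e) == v]| =
    #|[set e in C | (if o e then tail e else head e) == v]|.

Definition chi (G : multigraph) (C : {set edge G}) (o : edge G -> bool)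
    (e : edge G) : int :=
  if e \in C then (if o e then 1 else -1) else 0.

(* f + t * chi_C, with chi_C reduced mod q *)
Definition shift (G : multigraph) (q : nat) (o : {set edge G} -> edge G -> bool)
    (f : {ffun edge G -> 'Z_q}) (t : 'Z_q) (C : {set edge G}) :
    {ffun edge G -> 'Z_q} :=
  [ffun e => f e + t * (chi C (o C) e)%:~R].

Definition even_generating_set (G : multigraph) (q : nat)
    (o : {set edge G} -> edge G -> bool) (CC : {set {set edge G}}) : Prop :=
  (forall C, C \in CC -> even_subgraph C) /\
  (forall f : {ffun edge G -> 'Z_q},
     is_flow f <->
     exists c : {set edge G} -> 'Z_q,
       forall e, f e = \sum_(C in CC) c C * (chi C (o C) e)%:~R).

Definition gs_degree (G : multigraph) (CC : {set {set edge G}}) : nat :=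
  \max_(C in CC) #|[set D in CC :\ C | C :&: D != set0]|.

Definition gs_inter (G : multigraph) (CC : {set {set edge G}}) : nat :=
  \max_(C1 in CC) \max_(C2 in CC | C1 != C2) #|C1 :&: C2|.

Definition mu_flow (R : realType) (G : multigraph) (q : nat) (x : R)
    (f : {ffun edge G -> 'Z_q}) : R :=
  x ^+ #|supp f| / \sum_(g : flow G q) x ^+ #|supp (val g)|.

(* Choose C in CC uniformly and resample its coefficient proportionally to
   mu_flow.  The lemmas flow_chain_move, flow_chain_stay and flow_chain_other
   below give the transition probabilities case by case; this form also makes
   sense when the empty subgraph, for which chi_C = 0, belongs to CC. *)
Definition flow_chain (R : realType) (G : multigraph) (q : nat)
    (o : {set edge G} -> edge G -> bool) (CC : {set {set edge G}}) (x : R)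
    (f g : flow G q) : R :=
  (#|CC|%:R)^-1 *
  \sum_(C in CC) \sum_(t : 'Z_q | shift o (val f) t C == val g)
    mu_flow x (shift o (val f) t C) /
      \sum_(u : 'Z_q) mu_flow x (shift o (val f) u C).

Fixpoint nstep (R : realType) (T : finType) (P : T -> T -> R) (n : nat)
    (a b : T) : R :=
  if n is m.+1 then \sum_(c : T) nstep P m a c * P c b else (a == b)%:R.

Definition tv_dist (R : realType) (T : finType) (p p' : T -> R) : R :=
  2^-1 * \sum_(a : T) `|p a - p' a|.

Definition mixed (R : realType) (T : finType) (P : T -> T -> R) (pi : T -> R)
    (delta : R) (n : nat) : Prop :=
  forall a : T, tv_dist (nstep P n a) pi <= delta.

Definition is_mixing_time (R : realType) (T : finType) (P : T -> T -> R)
    (pi : T -> R) (delta : R) (n : nat) : Prop :=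
  mixed P pi delta n /\ forall m, mixed P pi delta m -> (n <= m)%N.

Definition flow_mixing_time (R : realType) (G : multigraph) (q : nat)
    (o : {set edge G} -> edge G -> bool) (CC : {set {set edge G}}) (x delta : R)
    (n : nat) : Prop :=
  is_mixing_time (@flow_chain R G q o CC x) (fun f => mu_flow x (val f)) delta n.

Lemma shift0 (G : multigraph) (q : nat) (o : {set edge G} -> edge G -> bool)
    (f : {ffun edge G -> 'Z_q}) (C : {set edge G}) : shift o f 0 C = f.
Proof. by apply/ffunP=> e; rewrite ffunE mul0r addr0. Qed.

Lemma shift_eqP (G : multigraph) (q : nat) (o : {set edge G} -> edge G -> bool)
    (f : {ffun edge G -> 'Z_q}) (t u : 'Z_q) (C D : {set edge G}) :
  C != set0 -> t != 0 -> shift o f u D = shift o f t C -> D = C /\ u = t.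
Proof.
move=> C0 t0 /ffunP eqs.
have {}eqs e : u * (chi D (o D) e)%:~R = t * (chi C (o C) e)%:~R.
  by have := eqs e; rewrite !ffunE => /addrI.
have chi_neq0 (s : 'Z_q) (A : {set edge G}) e :
    s != 0 -> (s * (chi A (o A) e)%:~R != 0) = (e \in A).
  move=> s0; rewrite /chi; case: ifP => _; last by rewrite mulr0 eqxx.
  by case: ifP => _; rewrite ?mulr1 ?mulrN1 ?oppr_eq0.
have [e0 e0C] := set0Pn _ C0.
have u0 : u != 0.
  apply: contraTneq e0C => uE.
  by rewrite -(chi_neq0 t) // -eqs uE mul0r eqxx.
have DC : D = C by apply/setP=> e; rewrite -(chi_neq0 u) // eqs chi_neq0.
split=> //; move: (eqs e0); rewrite DC /chi e0C.
by case: ifP => _; rewrite ?mulr1 ?mulrN1 // => /oppr_inj.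
Qed.

Lemma flow_chain_move (R : realType) (G : multigraph) (q : nat)
    (o : {set edge G} -> edge G -> bool) (CC : {set {set edge G}}) (x : R)
    (f g : flow G q) (t : 'Z_q) (C : {set edge G}) :
  C \in CC -> C != set0 -> t != 0 -> val g = shift o (val f) t C ->
  flow_chain o CC x f g =
    (#|CC|%:R)^-1 *
    (mu_flow x (val g) / \sum_(u : 'Z_q) mu_flow x (shift o (val f) u C)).
Proof.
move=> CCC C0 t0 gE; rewrite /flow_chain (bigD1 C) //= [X in _ + X]big1.
  rewrite addr0 (big_pred1 t) ?gE // => u /=.
  by apply/eqP/eqP => [/shift_eqP[]|->].
move=> D /andP[_ DC]; rewrite big_pred0 // => u; apply: contraNF DC => /eqP.
by rewrite gE => /shift_eqP[] // ->.
Qed.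

Lemma flow_chain_stay (R : realType) (G : multigraph) (q : nat)
    (o : {set edge G} -> edge G -> bool) (CC : {set {set edge G}}) (x : R)
    (f : flow G q) :
  set0 \notin CC ->
  flow_chain o CC x f f =
    (#|CC|%:R)^-1 *
    \sum_(C in CC)
      mu_flow x (val f) / \sum_(u : 'Z_q) mu_flow x (shift o (val f) u C).
Proof.
move=> CC0; rewrite /flow_chain; congr (_ * _); apply: eq_bigr => C CCC.
have C0 : C != set0 by apply: contraNneq CC0 => <-.
rewrite (big_pred1 0) ?shift0 // => u /=.
apply/eqP/eqP => [uE|->]; last exact: shift0.
apply/eqP; apply: contraT => u0.
have /(shift_eqP C0 u0)[_ uE'] : shift o (val f) 0 C = shift o (val f) u C.
  by rewrite uE shift0.
by rewrite -uE' eqxx in u0.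
Qed.

Lemma flow_chain_other (R : realType) (G : multigraph) (q : nat)
    (o : {set edge G} -> edge G -> bool) (CC : {set {set edge G}}) (x : R)
    (f g : flow G q) :
  (forall t C, C \in CC -> val g <> shift o (val f) t C) ->
  flow_chain o CC x f g = 0.
Proof.
move=> gN; rewrite /flow_chain big1 ?mulr0 // => C CCC.
by rewrite big_pred0 // => t; apply/eqP => /esym; apply: gN.
Qed.

(* Main.v *)
Require Import Defs.
From mathcomp Require Import all_boot all_order all_algebra.
From mathcomp Require Import reals sequences exp.
From mathcomp Require Import lra ring.

(* Path coupling in dual form.  Call a function on flows L-Lipschitz if adding
   a multiple of some chi_C (C in CC) changes it by at most L.  Compare one step
   of the chain at f and at f + t chi_C: resampling C gives the same law;
   resampling another D moves both flows by multiples of chi_D, which costs L,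
   plus the discrepancy between the two conditional laws of the multiple.  That
   discrepancy vanishes when D is disjoint from C; otherwise the cross ratios of
   the two laws are at least x ^ (2 |C :&: D|), so by Birkhoff's contraction
   estimate it costs at most L (1 - a) / (1 + a) with a = x ^ iota.  At most d
   subgraphs D contribute, hence a step contracts Lipschitz constants by a
   factor 1 - b, with b > 0 above the critical value of x.  Any two flows are
   joined by at most r moves, so after n steps the total variation distance to
   mu_flow is at most r (1 - b) ^ n. *)

Set Implicit Arguments.
Unset Strict Implicit.
Unset Printing Implicit Defensive.

Import Order.TTheory GRing.Theory Num.Theory.
Local Open Scope ring_scope.

Lemma sumr_gt0 (R : numDomainType) (T : finType) (F : T -> R) (a : T) :
  (forall b, 0 <= F b) -> 0 < F a -> 0 < \sum_b F b.
Proof.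
move=> F_ge0 Fa_gt0; rewrite (bigD1 a) //=.
by apply: ltr_pwDl => //; apply: sumr_ge0.
Qed.

Lemma card_sum_mem (T : finType) (A : {set T}) :
  #|A| = (\sum_a (a \in A))%N.
Proof. by rewrite -sum1_card big_mkcond. Qed.

Lemma bernoulli_le (R : realFieldType) (x : R) (n : nat) :
  0 <= x <= 1 -> 1 - n%:R * (1 - x) <= x ^+ n.
Proof.
move=> /andP[x0 x1]; elim: n => [|n IHn]; first by rewrite mul0r subr0 expr0.
rewrite exprS -natr1.
have := exprn_ile1 n x0 x1; have := exprn_ge0 n x0; have := ler0n R n.
by nra.
Qed.

Lemma ln_ge_half (R : realType) (y : R) : 2 <= y -> 2^-1 <= ln y.
Proof.
move=> y2; have y0 : 0 < y by lra.
have yV : y^-1 <= 2^-1 by rewrite lef_pV2 ?posrE.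
have : ln (1 + (y^-1 - 1)) <= y^-1 - 1.
  by apply: le_ln1Dx; rewrite ltrDr invr_gt0.
by rewrite addrC subrK lnV ?posrE //; lra.
Qed.

Lemma expr_decay_le (R : realType) (b delta r : R) (n : nat) :
  0 < b <= 1 -> 0 < delta -> 0 < r -> ln (r / delta) / b <= n%:R ->
  (1 - b) ^+ n * r <= delta.
Proof.
move=> /andP[b0 b1] delta0 r0; rewrite ler_pdivrMr // => hn.
rewrite -ler_pdivlMr // -[leRHS]lnK ?posrE ?divr_gt0 //.
rewrite -invf_div lnV ?posrE ?divr_gt0 //.
apply: (@le_trans _ _ (expR (- b) ^+ n)).
  by apply: lerXn2r; rewrite ?nnegrE ?subr_ge0 ?expR_ge0 ?expR_ge1Dx.
by rewrite -expRM_natl ler_expR; lra.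
Qed.

(* [(1 - b) ^+ n * r <= delta] as soon as [n >= ln (r / delta) / b]; the factor
   2 pays for rounding up to an integer. *)
Definition mixing_steps (R : realType) (b r delta : R) : R :=
  2 * (ln (r / delta) / b).

Lemma mixing_steps_ge1 (R : realType) (b r delta : R) :
  0 < b <= 1 -> 0 < delta -> 2 * delta <= r -> 1 <= mixing_steps b r delta.
Proof.
move=> /andP[b0 b1] delta0 delta_r.
have ln2 : 2^-1 <= ln (r / delta) by rewrite ln_ge_half // ler_pdivlMr.
by rewrite -ler_pdivrMl // mulr1 ler_pdivlMr //; lra.
Qed.

(* If [a ^+ 2 = expR (- D)] then this is [tanh (D / 4)], Birkhoff's contraction
   coefficient for projective diameter [D]. *)
Definition birkhoff_coef (R : realFieldType) (a : R) : R := (1 - a) / (1 + a).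

Lemma birkhoff_coef1 (R : realFieldType) : birkhoff_coef (1 : R) = 0.
Proof. by rewrite /birkhoff_coef subrr mul0r. Qed.

Lemma birkhoff_coef_ge0 (R : realFieldType) (a : R) :
  0 <= a <= 1 -> 0 <= birkhoff_coef a.
Proof. by move=> /andP[a0 a1]; rewrite divr_ge0 ?subr_ge0 ?addr_ge0. Qed.

Lemma birkhoff_coef_anti (R : realFieldType) (a b : R) :
  0 <= a <= b -> birkhoff_coef b <= birkhoff_coef a.
Proof.
move=> /andP[a0 ab]; rewrite /birkhoff_coef ler_pdivrMr; last lra.
by rewrite mulrAC ler_pdivlMr; nra.
Qed.

Definition dobrushin_bound (R : realFieldType) (d n x : R) : R :=
  (d + 1) * (n * (1 - x) / 2).

Lemma dobrushin_bound_ge0 (R : realFieldType) (d n x : R) :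
  0 <= d -> 0 <= n -> x <= 1 -> 0 <= dobrushin_bound d n x.
Proof.
move=> d0 n0 x1.
by rewrite mulr_ge0 ?addr_ge0 ?divr_ge0 ?mulr_ge0 ?subr_ge0.
Qed.

Lemma dobrushin_bound_gap (R : realFieldType) (d n x : R) :
  0 < d -> 0 < n ->
  1 - dobrushin_bound d n x =
    (d + 1) * n / 2 * (x - (1 - 2 / ((d + 1) * n))).
Proof.
by move=> d0 n0; rewrite /dobrushin_bound; field; rewrite !gt_eqF //; lra.
Qed.

Lemma dobrushin_bound_lt1 (R : realFieldType) (d n x : R) :
  0 < d -> 0 < n ->
  (dobrushin_bound d n x < 1) = (1 - 2 / ((d + 1) * n) < x).
Proof.
move=> d0 n0; rewrite -subr_gt0 dobrushin_bound_gap // pmulr_rgt0 ?subr_gt0 //.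
by rewrite divr_gt0 ?mulr_gt0 ?addr_gt0.
Qed.

(* With [y = n (1 - x) / 2], Bernoulli's inequality [x ^+ n >= 1 - 2 y] gives
   [birkhoff_coef (x ^+ n) <= y / (1 - y)], and [1 - y >= d / (d + 1)]. *)
Lemma birkhoff_coef_expn_le (R : realFieldType) (d x : R) (n : nat) :
  0 <= d -> 0 < x <= 1 -> dobrushin_bound d n%:R x <= 1 ->
  d * birkhoff_coef (x ^+ n) <= dobrushin_bound d n%:R x.
Proof.
rewrite /dobrushin_bound => d0 /andP[x0 x1] y1.
have y0 : 0 <= n%:R * (1 - x) / 2 by rewrite divr_ge0 ?mulr_ge0 ?subr_ge0.
have bern : 1 - 2 * (n%:R * (1 - x) / 2) <= x ^+ n.
  have -> : 2 * (n%:R * (1 - x) / 2) = n%:R * (1 - x) by field.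
  by rewrite bernoulli_le // ltW.
have := exprn_gt0 n x0.
move: (n%:R * (1 - x) / 2) (x ^+ n) y0 y1 bern => y a y0 y1 bern a0.
rewrite /birkhoff_coef mulrA ler_pdivrMr; last lra.
have : 0 <= ((d + 1) * y + d) * (a - (1 - 2 * y)).
  by rewrite mulr_ge0 ?subr_ge0 ?addr_ge0 ?mulr_ge0 ?addr_ge0.
have : 0 <= y * (1 - (d + 1) * y) by rewrite mulr_ge0 ?subr_ge0.
lra.
Qed.

(* For [A = s ^+ 2], [B = t ^+ 2], [A' = s' ^+ 2], [B' = t' ^+ 2], the
   difference of the two sides is
   [(1 - a) (s s' - t t') ^+ 2 + 2 (s t' + s' t) (s' t - a s t')]. *)
Lemma birkhoff_contraction2 (R : rcfType) (a A B A' B' : R) :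
  0 <= a <= 1 -> 0 <= A -> 0 <= B -> 0 <= A' -> 0 <= B' ->
  a ^+ 2 * (A * B') <= A' * B ->
  (A * B' - A' * B) * (1 + a) <= (1 - a) * ((A + B) * (A' + B')).
Proof.
move=> /andP[a0 a1] A0 B0 A'0 B'0.
rewrite -(sqr_sqrtr A0) -(sqr_sqrtr B0) -(sqr_sqrtr A'0) -(sqr_sqrtr B'0).
move: (sqrtr_ge0 A) (sqrtr_ge0 B) (sqrtr_ge0 A') (sqrtr_ge0 B').
move: (Num.sqrt A) (Num.sqrt B) (Num.sqrt A') (Num.sqrt B').
move=> s t s' t' s0 t0 s'0 t'0.
rewrite -!exprMn ler_sqr ?nnegrE ?mulr_ge0 // => cross.
rewrite -subr_ge0.
have -> : (1 - a) * ((s ^+ 2 + t ^+ 2) * (s' ^+ 2 + t' ^+ 2)) -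
    ((s * t') ^+ 2 - (s' * t) ^+ 2) * (1 + a) =
    (1 - a) * (s * s' - t * t') ^+ 2 +
    2 * ((s * t' + s' * t) * (s' * t - a * (s * t'))) by ring.
rewrite addr_ge0 // mulr_ge0 ?sqr_ge0 ?subr_ge0 //.
by rewrite mulr_ge0 ?subr_ge0 ?addr_ge0 ?mulr_ge0.
Qed.

Section WeightedMean.
Variables (R : rcfType) (U : finType).
Implicit Types (w h : U -> R) (a m L : R).

Definition weighted_mean w h : R := (\sum_u w u * h u) / \sum_u w u.

Lemma eq_weighted_mean w w' h h' :
  w =1 w' -> h =1 h' -> weighted_mean w h = weighted_mean w' h'.
Proof.
move=> ww' hh'; congr (_ / _); apply: eq_bigr => u _ //.
by rewrite ww' hh'.
Qed.

Lemma weighted_mean_affine w h m L :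
  \sum_u w u != 0 ->
  weighted_mean w (fun u => m + L * h u) = m + L * weighted_mean w h.
Proof.
move=> w0; rewrite /weighted_mean.
under eq_bigr do rewrite mulrDr mulrCA.
rewrite big_split /= -mulr_suml -mulr_sumr mulrDl.
by rewrite mulrAC divff // mul1r mulrA.
Qed.

Lemma weighted_mean_dist_le w h h' L :
  (forall u, 0 <= w u) -> 0 < \sum_u w u -> (forall u, `|h u - h' u| <= L) ->
  `|weighted_mean w h - weighted_mean w h'| <= L.
Proof.
move=> w0 W0 hh'; rewrite -mulrBl -sumrB.
rewrite normrM [X in _ * X]gtr0_norm ?invr_gt0 //.
rewrite ler_pdivrMr // mulr_sumr (le_trans (ler_norm_sum _ _ _)) //.
apply: ler_sum => u _.
by rewrite -mulrBr normrM ger0_norm // mulrC ler_wpM2r.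
Qed.

(* Invariant under rescaling of [w] and [w'], so that the common factors of
   conditional weights need not be split off. *)
Definition cross_ratio_ge a w w' : Prop :=
  forall u v, a ^+ 2 * (w u * w' v) <= w' u * w v.

Lemma cross_ratio_ge_sym a w w' :
  cross_ratio_ge a w w' -> cross_ratio_ge a w' w.
Proof. by move=> cross u v; rewrite (mulrC (w' u)) (mulrC (w u)). Qed.

Lemma unit_weighted_mean_diff_le a w w' h :
  0 <= a <= 1 -> (forall u, 0 <= w u) -> (forall u, 0 <= w' u) ->
  0 < \sum_u w u -> 0 < \sum_u w' u -> cross_ratio_ge a w w' ->
  (forall u, 0 <= h u <= 1) ->
  weighted_mean w h - weighted_mean w' h <= birkhoff_coef a.
Proof.
move=> a01 w0 w'0 W0 W'0 cross h01.
have h0 u : 0 <= h u by case/andP: (h01 u).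
have hC0 u : 0 <= 1 - h u by rewrite subr_ge0; case/andP: (h01 u).
pose A (k : U -> R) := \sum_u k u * h u.
pose B (k : U -> R) := \sum_u k u * (1 - h u).
have sumAB k : \sum_u k u = A k + B k.
  by rewrite -big_split /=; apply: eq_bigr => u _; ring.
have A0 k : (forall u, 0 <= k u) -> 0 <= A k.
  by move=> k0; apply: sumr_ge0 => u _; rewrite mulr_ge0.
have B0 k : (forall u, 0 <= k u) -> 0 <= B k.
  by move=> k0; apply: sumr_ge0 => u _; rewrite mulr_ge0.
have crossAB : a ^+ 2 * (A w * B w') <= A w' * B w.
  rewrite !big_distrlr mulr_sumr; apply: ler_sum => u _.
  rewrite mulr_sumr; apply: ler_sum => v _.
  by rewrite /= !(mulrACA _ (h u)) (mulrA (a ^+ 2)) ler_wpM2r // mulr_ge0.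
have a10 : 0 < 1 + a by lra.
have -> : weighted_mean w h - weighted_mean w' h =
    (A w * B w' - A w' * B w) / ((A w + B w) * (A w' + B w')).
  rewrite -!sumAB /weighted_mean -/(A w) -/(A w') -mulNr addf_div ?gt_eqF //.
  by congr (_ / _); rewrite !sumAB; ring.
rewrite -!sumAB ler_pdivrMr ?mulr_gt0 // /birkhoff_coef mulrAC ler_pdivlMr //.
by rewrite !sumAB birkhoff_contraction2 ?A0 ?B0.
Qed.

Lemma oscillation_normalize (u0 : U) h L :
  (forall u v, `|h u - h v| <= L) ->
  exists m k, (forall u, 0 <= k u <= 1) /\ h =1 (fun u => m + L * k u).
Proof.
move=> hL; have L0 : 0 <= L by apply: le_trans (hL u0 u0).
have [m m_le m_ge] : exists2 m, forall u, m <= h u & forall u, h u <= m + L.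
  exists (h [arg min_(u < u0) h u]%O); case: arg_minP => // v _ h_min u.
    exact: h_min.
  by have := hL u v; rewrite ler_norml => /andP[_]; rewrite lerBlDl.
exists m, (fun u => (h u - m) / L); split=> u.
  have [->|Lneq0] := eqVneq L 0; first by rewrite invr0 mulr0 lexx ler01.
  have L_gt0 : 0 < L by rewrite lt_neqAle eq_sym Lneq0.
  by rewrite ler_pdivrMr // mul1r lerBlDl m_ge divr_ge0 ?subr_ge0.
have [L_eq0|Lneq0] := eqVneq L 0; last by rewrite mulrC divfK // addrC subrK.
apply/eqP; rewrite L_eq0 mul0r addr0 eq_le m_le andbT.
by have := m_ge u; rewrite L_eq0 addr0.
Qed.

Lemma weighted_mean_contraction a w w' h L :
  0 <= a <= 1 -> (forall u, 0 <= w u) -> (forall u, 0 <= w' u) ->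
  0 < \sum_u w u -> 0 < \sum_u w' u -> cross_ratio_ge a w w' ->
  (forall u v, `|h u - h v| <= L) ->
  `|weighted_mean w h - weighted_mean w' h| <= L * birkhoff_coef a.
Proof.
move=> a01 w0 w'0 W0 W'0 cross hL.
case: (pickP U) => [u0 _|U0]; last by rewrite big_pred0 ?ltxx in W0.
have L0 : 0 <= L by apply: le_trans (hL u0 u0).
have [m [k [k01 hE]]] := oscillation_normalize u0 hL.
rewrite !(eq_weighted_mean (frefl _) hE) !weighted_mean_affine ?gt_eqF //.
rewrite opprD addrACA subrr add0r -mulrBr normrM ger0_norm // ler_wpM2l //.
rewrite ler_norml lerNl opprB !unit_weighted_mean_diff_le //.
exact: cross_ratio_ge_sym.
Qed.

End WeightedMean.

Section MarkovChain.
Variables (R : realType) (T : finType).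
Implicit Types (P : T -> T -> R) (p pi h : T -> R) (e : rel T).

Definition distribution p : Prop := (forall a, 0 <= p a) /\ \sum_a p a = 1.

Definition markov_op P h (a : T) : R := \sum_b P a b * h b.

Definition stationary P pi : Prop :=
  forall h, \sum_a pi a * markov_op P h a = \sum_a pi a * h a.

Lemma markov_op_nstep0 P h : markov_op (nstep P 0) h =1 h.
Proof.
move=> a; rewrite /markov_op (bigD1 a) //= eqxx mul1r big1 ?addr0 // => b.
by rewrite eq_sym => /negPf ->; rewrite mul0r.
Qed.

Lemma markov_op_nstepS P n h :
  markov_op (nstep P n.+1) h =1 markov_op (nstep P n) (markov_op P h).
Proof.
move=> a; rewrite /markov_op; under eq_bigr do rewrite /= mulr_suml.
rewrite exchange_big /=; apply: eq_bigr => c _.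
by rewrite mulr_sumr; apply: eq_bigr => b _; rewrite mulrA.
Qed.

Lemma nstep_stationary P pi n : stationary P pi -> stationary (nstep P n) pi.
Proof.
move=> piP; elim: n => [|n IHn] h; apply/esym.
  by under [RHS]eq_bigr do rewrite markov_op_nstep0.
by under [RHS]eq_bigr do rewrite markov_op_nstepS; rewrite IHn piP.
Qed.

Lemma nstep0_distribution P a : distribution (nstep P 0 a).
Proof.
split=> [b|]; first by rewrite ler0n.
rewrite (bigD1 a) //= eqxx big1 ?addr0 // => b.
by rewrite eq_sym => /negPf ->.
Qed.

Lemma tv_dist_le1 p p' : distribution p -> distribution p' -> tv_dist p p' <= 1.
Proof.
move=> [p0 p1] [p'0 p'1]; rewrite /tv_dist ler_pdivrMl // mulr1.
rewrite [leRHS](_ : _ = \sum_a (p a + p' a)); last by rewrite big_split p1 p'1.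
apply: ler_sum => a _; apply: le_trans (ler_normB _ _) _.
by rewrite !ger0_norm.
Qed.

Lemma tv_dist_subsingleton p p' :
  (forall a b : T, a = b) -> distribution p -> distribution p' ->
  tv_dist p p' = 0.
Proof.
move=> T1 [_ p1] [_ p'1]; rewrite /tv_dist big1 ?mulr0 // => a _.
have sum1 (k : T -> R) : \sum_b k b = k a.
  by apply: big_pred1 => b; rewrite (T1 b a) /= eqxx.
by rewrite -[p a]sum1 -[p' a]sum1 p1 p'1 subrr normr0.
Qed.

Lemma tv_dist_dual p p' :
  exists h, (forall a b, `|h a - h b| <= 1) /\
    tv_dist p p' = \sum_a (p a - p' a) * h a.
Proof.
exists (fun a => Num.sg (p a - p' a) / 2); split=> [a b|].
  by do 2![case: sgrP => _]; rewrite ler_norml; apply/andP; split; lra.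
rewrite /tv_dist mulr_sumr; apply: eq_bigr => a _.
by rewrite [in LHS]normrEsg; ring.
Qed.

Lemma tv_dist_stationary_le P pi M a :
  distribution pi -> stationary P pi ->
  (forall h, (forall b c, `|h b - h c| <= 1) ->
     forall b c, `|markov_op P h b - markov_op P h c| <= M) ->
  tv_dist (P a) pi <= M.
Proof.
move=> [pi0 pi1] piP osc; have [h [h1 ->]] := tv_dist_dual (P a) pi.
under eq_bigr do rewrite mulrBl; rewrite sumrB -piP.
rewrite -[X in X - _]mul1r -[leRHS]mul1r -pi1 !mulr_suml -sumrB.
apply: ler_sum => b _; rewrite -mulrBr ler_wpM2l //.
by apply: le_trans (ler_norm _) (osc _ h1 _ _).
Qed.

Definition lipschitz e (L : R) h : Prop :=
  forall a b, e a b -> `|h a - h b| <= L.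

Definition diameter_le e (m : nat) : Prop :=
  forall a b, exists s, [/\ path e a s, last a s = b & (size s <= m)%N].

Lemma eq_lipschitz e L h h' : h =1 h' -> lipschitz e L h -> lipschitz e L h'.
Proof. by move=> hh' hL a b ab; rewrite -!hh' hL. Qed.

Lemma lipschitz_path e L h a s :
  lipschitz e L h -> path e a s -> `|h a - h (last a s)| <= L * (size s)%:R.
Proof.
move=> hL; elim: s a => [|b s IHs] a /=; first by rewrite subrr normr0 mulr0.
move=> /andP[ab bs]; rewrite -nat1r mulrDr mulr1.
by apply: le_trans (ler_distD (h b) _ _) _; rewrite lerD ?hL ?IHs.
Qed.

Lemma lipschitz_diameter e L h m :
  0 <= L -> lipschitz e L h -> diameter_le e m ->
  forall a b, `|h a - h b| <= L * m%:R.
Proof.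
move=> L0 hL em a b; have [s [path_s <- sm]] := em a b.
by apply: le_trans (lipschitz_path hL path_s) _; rewrite ler_wpM2l // ler_nat.
Qed.

Definition lipschitz_contraction e (lam : R) P : Prop :=
  forall L h,
    0 <= L -> lipschitz e L h -> lipschitz e (lam * L) (markov_op P h).

Lemma nstep_lipschitz_contraction e lam P n :
  0 <= lam -> lipschitz_contraction e lam P ->
  lipschitz_contraction e (lam ^+ n) (nstep P n).
Proof.
move=> lam0 lamP; elim: n => [|n IHn] L h L0 hL.
  by rewrite mul1r; apply: eq_lipschitz hL => a; rewrite markov_op_nstep0.
apply: eq_lipschitz (fun a => esym (markov_op_nstepS P n h a)) _.
by rewrite exprSr -mulrA; apply: IHn; [rewrite mulr_ge0 | apply: lamP].
Qed.

Lemma path_coupling e m lam P pi n a :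
  0 <= lam -> diameter_le e m -> lipschitz_contraction e lam P ->
  distribution pi -> stationary P pi ->
  tv_dist (nstep P n a) pi <= lam ^+ n * m%:R.
Proof.
move=> lam0 em lamP pi1 piP.
apply: tv_dist_stationary_le (nstep_stationary n piP) _ => // h h1.
apply: lipschitz_diameter em; first exact: exprn_ge0.
rewrite -[lam ^+ n]mulr1.
by apply: nstep_lipschitz_contraction => // b c _; apply: h1.
Qed.

Lemma mixing_time_exists_le P pi delta n :
  mixed P pi delta n -> exists2 t, is_mixing_time P pi delta t & (t <= n)%N.
Proof.
pose mixedb m := [forall a, tv_dist (nstep P m a) pi <= delta].
have mixedP m : reflect (mixed P pi delta m) (mixedb m) by apply: forallP.
move=> mn; have ex_mixed : exists m, mixedb m by exists n; apply/mixedP.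
exists (ex_minn ex_mixed); case: ex_minnP => t /mixedP mt t_min.
  by split=> // m /mixedP; apply: t_min.
by apply: t_min; apply/mixedP.
Qed.

Lemma mixing_time_le P pi (b delta r : R) :
  0 < b <= 1 -> 0 < delta <= r ->
  (forall n a, tv_dist (nstep P n a) pi <= (1 - b) ^+ n * r) ->
  exists2 t, is_mixing_time P pi delta t &
    t%:R <= Num.max 1 (mixing_steps b r delta).
Proof.
move=> b01 /andP[delta0 delta_le] decay.
rewrite /mixing_steps; set A := ln _ / b.
have r0 : 0 < r by apply: lt_le_trans delta_le.
have A0 : 0 <= A.
  by rewrite divr_ge0 ?ln_ge0 ?ler_pdivlMr ?mul1r // ltW //; case/andP: b01.
have /andP[truncA Atrunc] := truncn_itv A0.
have [|t mixt tA] := @mixing_time_exists_le P pi delta (Num.truncn A).+1.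
  by move=> a; apply: le_trans (decay _ a) _; rewrite expr_decay_le // ltW.
exists t => //; apply: (@le_trans _ _ (Num.truncn A).+1%:R).
  by rewrite ler_nat.
rewrite le_max; have [A1|A1] := leP 1 A.
  by apply/orP; right; rewrite -natr1; lra.
by rewrite (_ : Num.truncn A = 0%N) ?lexx //; apply/truncn_def; rewrite A0.
Qed.

End MarkovChain.

Section HeatBath.
Variables (R : realType) (T I : finType) (U : finZmodType) (A : {set I}).
Variables (move : I -> U -> T -> T) (mu : T -> R).
Hypothesis move0 : {in A, forall i, move i 0 =1 id}.
Hypothesis moveD :
  {in A, forall i u v a, move i v (move i u a) = move i (u + v) a}.
Hypothesis moveC :
  {in A &, forall i j u v a, move j v (move i u a) = move i u (move j v a)}.
Hypothesis mu_gt0 : forall a, 0 < mu a.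
Implicit Types (h : T -> R) (L : R).

Definition resample i h (a : T) : R :=
  weighted_mean (fun u => mu (move i u a)) (fun u => h (move i u a)).

Definition heat_bath h (a : T) : R :=
  #|A|%:R^-1 * \sum_(i in A) resample i h a.

Definition adjacent : rel T :=
  fun a b => [exists i in A, exists u, b == move i u a].

Lemma adjacentP a b :
  reflect (exists i u, i \in A /\ b = move i u a) (adjacent a b).
Proof.
apply: (iffP exists_inP) => [[i iA /existsP[u /eqP ->]]|[i [u [iA ->]]]].
  by exists i, u.
by exists i => //; apply/existsP; exists u.
Qed.

Lemma adjacent_move i u a : i \in A -> adjacent a (move i u a).
Proof. by move=> iA; apply/adjacentP; exists i, u. Qed.

Lemma sum_move_gt0 i a : 0 < \sum_u mu (move i u a).
Proof. by apply: (@sumr_gt0 _ _ _ 0) => [u|]; rewrite ?ltW ?mu_gt0. Qed.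

Lemma sum_orbit i t a (F : T -> R) :
  i \in A -> \sum_u F (move i u (move i t a)) = \sum_u F (move i u a).
Proof.
move=> iA; rewrite [RHS](reindex_inj (addrI t)).
by apply: eq_bigr => u _; rewrite moveD.
Qed.

Lemma resample_move i t h a :
  i \in A -> resample i h (move i t a) = resample i h a.
Proof.
move=> iA; congr (_ / _); last exact: sum_orbit.
exact: (sum_orbit _ _ (fun b => mu b * h b)).
Qed.

Lemma sum_resample i h :
  i \in A -> \sum_a mu a * resample i h a = \sum_a mu a * h a.
Proof.
move=> iA; pose Z a := \sum_u mu (move i u a).
have moveK u : cancel (move i u) (move i (- u)).
  by move=> a; rewrite moveD // subrr move0.
transitivity (\sum_u \sum_a mu (move i (- u) a) * (mu a * h a / Z a)).
  transitivity
      (\sum_u \sum_a mu a * (mu (move i u a) * h (move i u a) / Z a)).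
    rewrite exchange_big; apply: eq_bigr => a _.
    by rewrite -mulr_sumr -mulr_suml.
  apply: eq_bigr => u _; rewrite [RHS](reindex_inj (can_inj (moveK u))).
  by apply: eq_bigr => a _; rewrite moveK /Z sum_orbit.
rewrite exchange_big; apply: eq_bigr => a _; rewrite -mulr_suml.
rewrite (reindex_inj oppr_inj); under eq_bigr do rewrite opprK.
by rewrite mulrC divfK // gt_eqF // sum_move_gt0.
Qed.

Lemma sum_heat_bath h :
  (0 < #|A|)%N -> \sum_a mu a * heat_bath h a = \sum_a mu a * h a.
Proof.
move=> A0; under eq_bigr do rewrite mulrCA mulr_sumr.
rewrite -mulr_sumr exchange_big /=.
under eq_bigr do rewrite sum_resample //.
by rewrite sumr_const -[X in _ * X]mulr_natl mulKf // pnatr_eq0 -lt0n.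
Qed.

Lemma resample_move_dist i j t h a c L :
  i \in A -> j \in A -> 0 <= c <= 1 ->
  cross_ratio_ge c (fun u => mu (move j u a))
    (fun u => mu (move j u (move i t a))) ->
  lipschitz adjacent L h ->
  `|resample j h a - resample j h (move i t a)| <= L + L * birkhoff_coef c.
Proof.
move=> iA jA c01 cross hL; pose w u := mu (move j u (move i t a)).
have mu_ge0 b : 0 <= mu b by apply: ltW.
have w_ge0 u : 0 <= w u by apply: mu_ge0.
apply: le_trans (ler_distD (weighted_mean w (fun u => h (move j u a))) _ _) _.
rewrite addrC lerD //; last first.
  apply: weighted_mean_contraction => //; try exact: sum_move_gt0.
  move=> u v; rewrite -[v](subrKC u) -moveD //.
  exact: hL (adjacent_move _ _ jA).
apply: weighted_mean_dist_le => // [|u]; first exact: sum_move_gt0.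
by rewrite moveC //; apply: hL (adjacent_move _ _ iA).
Qed.

(* Dobrushin's criterion: [birkhoff_coef (c i j)] bounds the influence of a move
   along [i] on the resampling along [j]. *)
Lemma heat_bath_lipschitz (c : I -> I -> R) (s L : R) h :
  (forall i j, 0 <= c i j <= 1) ->
  (forall i j t a, i \in A -> j \in A -> j != i ->
    cross_ratio_ge (c i j) (fun u => mu (move j u a))
      (fun u => mu (move j u (move i t a)))) ->
  (forall i, i \in A -> \sum_(j in A | j != i) birkhoff_coef (c i j) <= s) ->
  0 <= L -> lipschitz adjacent L h ->
  lipschitz adjacent ((1 - (1 - s) / #|A|%:R) * L) (heat_bath h).
Proof.
move=> c01 cross influence L0 hL a _ /adjacentP[i [t [iA ->]]].
have A0 : 0 < #|A|%:R :> R by rewrite ltr0n; apply/card_gt0P; exists i.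
rewrite -mulrBr -sumrB normrM gtr0_norm ?invr_gt0 // mulrC ler_pdivrMr //.
have -> : (1 - (1 - s) / #|A|%:R) * L * #|A|%:R = L * (#|A|%:R - 1) + L * s.
  by field; rewrite gt_eqF.
apply: le_trans (ler_norm_sum _ _ _) _.
rewrite (bigD1 i) //= resample_move // subrr normr0 add0r.
apply: (@le_trans _ _ (\sum_(j in A | j != i) (L + L * birkhoff_coef (c i j)))).
  apply: ler_sum => j /andP[jA ji].
  by apply: resample_move_dist => //; apply: cross.
rewrite big_split /= -mulr_sumr lerD ?ler_wpM2l ?influence //.
rewrite (cardsD1 i) iA natrD addrAC subrr add0r sumr_const mulr_natr.
by rewrite (eq_card (B := A :\ i)) // => j; rewrite !inE andbC.
Qed.

End HeatBath.

Section Shift.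
Variables (G : multigraph) (q : nat) (o : {set edge G} -> edge G -> bool).
Implicit Types (f g : {ffun edge G -> 'Z_q}) (t u : 'Z_q) (C D : {set edge G}).

Lemma shiftD f t u C : shift o (shift o f t C) u C = shift o f (t + u) C.
Proof. by apply/ffunP => e; rewrite !ffunE mulrDl addrA. Qed.

Lemma shiftAC f t u C D :
  shift o (shift o f t C) u D = shift o (shift o f u D) t C.
Proof. by apply/ffunP => e; rewrite !ffunE addrAC. Qed.

Lemma shift_notin f t C e : e \notin C -> shift o f t C e = f e.
Proof. by rewrite ffunE /chi => /negPf ->; rewrite mulr0 addr0. Qed.

Lemma supp_shift_exchange f g t C D :
  (forall e, e \notin D -> f e = g e) ->
  (#|supp (shift o f t C)| + #|supp g| <=
     #|C :&: D|.*2 + (#|supp f| + #|supp (shift o g t C)|))%N.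
Proof.
move=> fg; rewrite !card_sum_mem -muln2 big_distrl -!big_split /=.
apply: leq_sum => e _; rewrite !inE.
case: (boolP (e \in C)) => eC; last by rewrite !shift_notin.
case: (boolP (e \in D)) => eD; first by do !case: eqP.
by rewrite !ffunE fg // addnC.
Qed.

End Shift.

Section SubgraphFamily.
Variables (R : realType) (G : multigraph) (CC : {set {set edge G}}).
Implicit Types (C D : {set edge G}).

Lemma card_meeting_le C :
  C \in CC -> (#|[set D in CC :\ C | C :&: D != set0]| <= gs_degree CC)%N.
Proof. exact: leq_bigmax_cond. Qed.

Lemma card_setI_le C D :
  C \in CC -> D \in CC -> C != D -> (#|C :&: D| <= gs_inter CC)%N.
Proof.
move=> CCC DCC CD; apply: leq_trans (leq_bigmax_cond C CCC).
by apply: (leq_bigmax_cond D); rewrite DCC.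
Qed.

Lemma sum_birkhoff_coef_le (x : R) d io C :
  0 < x <= 1 -> (gs_degree CC <= d)%N -> (gs_inter CC <= io)%N -> C \in CC ->
  \sum_(D in CC | D != C) birkhoff_coef (x ^+ #|C :&: D|) <=
  d%:R * birkhoff_coef (x ^+ io).
Proof.
move=> /andP[x0 x1] hdeg hinter CCC.
have coef_ge0 : 0 <= birkhoff_coef (x ^+ io).
  by rewrite birkhoff_coef_ge0 // exprn_ge0 ?exprn_ile1 // ltW.
rewrite (bigID (fun D => C :&: D == set0)) /= big1 ?add0r; last first.
  by move=> D /andP[_ /eqP ->]; rewrite cards0 birkhoff_coef1.
pose meeting := [set D in CC :\ C | C :&: D != set0].
apply: (@le_trans _ _ (\sum_(D in meeting) birkhoff_coef (x ^+ io))).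
  rewrite (eq_bigl (mem meeting)) => [|D]; last first.
    by rewrite !inE (andbC (D != C)).
  apply: ler_sum => D; rewrite !inE => /andP[/andP[DC DCC] _].
  rewrite birkhoff_coef_anti // exprn_ge0 ?ler_wiXn2l ?(ltW x0) //.
  by rewrite (leq_trans _ hinter) // card_setI_le // eq_sym.
rewrite sumr_const -[leLHS]mulr_natl ler_wpM2r // ler_nat.
exact: leq_trans (card_meeting_le CCC) hdeg.
Qed.

End SubgraphFamily.

Section FlowMeasure.
Variables (R : realType) (G : multigraph) (q : nat).
Implicit Types (f : flow G q) (x : R).

Definition flow_measure x f : R := mu_flow x (val f).

Lemma flow_partition_function_gt0 x :
  0 < x -> 0 < \sum_(f : flow G q) x ^+ #|supp (val f)|.
Proof.
move=> x0; have is_flow0 : is_flow ([ffun=> 0] : {ffun edge G -> 'Z_q}).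
  by apply/forallP => v; rewrite !big1 // => e _; rewrite ffunE.
pose f0 : flow G q := exist (fun k => is_flow k) _ is_flow0.
by apply: (@sumr_gt0 _ _ _ f0) => [f|]; rewrite ?exprn_ge0 ?exprn_gt0 // ltW.
Qed.

Lemma flow_measure_gt0 x f : 0 < x -> 0 < flow_measure x f.
Proof.
by move=> x0; rewrite divr_gt0 ?exprn_gt0 ?flow_partition_function_gt0.
Qed.

Lemma flow_measure_distribution x : 0 < x -> distribution (flow_measure x).
Proof.
move=> x0; split=> [f|]; first by rewrite ltW ?flow_measure_gt0.
by rewrite -mulr_suml divff // gt_eqF ?flow_partition_function_gt0.
Qed.

End FlowMeasure.

Definition mixing_bound (R : realType) (d io r delta xi : R) : R :=
  4 * r / (d * io) * ln (r * delta^-1) * xi^-1.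

Lemma mixing_bound_ge0 (R : realType) (d io r delta xi : R) :
  0 < d -> 0 < io -> 0 < xi -> 0 < delta <= r ->
  0 <= mixing_bound d io r delta xi.
Proof.
move=> d0 io0 xi0 /andP[delta0 delta_r].
have r0 : 0 < r by apply: lt_le_trans delta_r.
have ln0 : 0 <= ln (r / delta) by rewrite ln_ge0 // ler_pdivlMr ?mul1r.
by rewrite /mixing_bound !mulr_ge0 ?invr_ge0 ?mulr_ge0 // ltW.
Qed.

Lemma mixing_steps_le_bound (R : realType) (d io r delta xi : R) :
  0 < d -> 0 < io -> 0 < xi -> 0 < delta <= r ->
  mixing_steps ((d + 1) * io / 2 * xi / r) r delta <=
  mixing_bound d io r delta xi.
Proof.
move=> d0 io0 xi0 /andP[delta0 delta_r].
have r0 : 0 < r by apply: lt_le_trans delta_r.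
have ln0 : 0 <= ln (r / delta) by rewrite ln_ge0 // ler_pdivlMr ?mul1r.
rewrite /mixing_steps /mixing_bound; move: (ln _) ln0 => l l0.
have -> : 2 * (l / ((d + 1) * io / 2 * xi / r)) =
    4 * r / ((d + 1) * io) * l * xi^-1.
  by field; rewrite !gt_eqF //; lra.
rewrite ler_wpM2r ?invr_ge0 ?(ltW xi0) // ler_wpM2r // ler_wpM2l //; first lra.
by rewrite lef_pV2 ?posrE ?mulr_gt0 ?ler_wpM2r //; lra.
Qed.

Section FlowChain.
Variables (R : realType) (G : multigraph) (q : nat).
Variables (o : {set edge G} -> edge G -> bool) (CC : {set {set edge G}}).
Hypothesis gen : even_generating_set q o CC.
Local Notation chain := (@flow_chain R G q o CC).
Implicit Types (f g : flow G q) (t u : 'Z_q) (C D : {set edge G}) (x : R).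

Lemma shift_is_flow f t C : C \in CC -> is_flow (shift o (val f) t C).
Proof.
have [_ genP] := gen; move=> CCC; have /genP[c fE] := valP f; apply/genP.
exists (fun D => c D + if D == C then t else 0) => e.
rewrite ffunE fE; under [RHS]eq_bigr do rewrite mulrDl.
rewrite big_split; congr (_ + _); rewrite (bigD1 C) //= eqxx big1 ?addr0 //.
by move=> D /andP[_ /negPf ->]; rewrite mul0r.
Qed.

(* For [C] outside [CC] the shifted function need not be a flow, and
   [flow_shift] is then the identity. *)
Definition flow_shift C t f : flow G q := insubd f (shift o (val f) t C).

Lemma val_flow_shift C t f :
  C \in CC -> val (flow_shift C t f) = shift o (val f) t C.
Proof. by move=> CCC; apply: insubdK; apply: shift_is_flow. Qed.

Lemma flow_shift0 : {in CC, forall C, flow_shift C 0 =1 id}.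
Proof. by move=> C CCC f; apply: val_inj; rewrite val_flow_shift // shift0. Qed.

Lemma flow_shiftD :
  {in CC, forall C t u f,
    flow_shift C u (flow_shift C t f) = flow_shift C (t + u) f}.
Proof.
by move=> C CCC t u f; apply: val_inj; rewrite !val_flow_shift // shiftD.
Qed.

Lemma flow_shiftC :
  {in CC &, forall C D t u f,
    flow_shift D u (flow_shift C t f) = flow_shift C t (flow_shift D u f)}.
Proof.
by move=> C D CCC DCC t u f; apply: val_inj; rewrite !val_flow_shift // shiftAC.
Qed.

(* Only the edges of [C :&: D] matter: those outside [C] are not moved by
   [flow_shift C], and the factors of those outside [D] cancel. *)
Lemma flow_measure_cross_ratio x C D t f :
  C \in CC -> D \in CC -> 0 < x <= 1 ->
  cross_ratio_ge (x ^+ #|C :&: D|) (fun u => flow_measure x (flow_shift D u f))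
    (fun u => flow_measure x (flow_shift D u (flow_shift C t f))).
Proof.
move=> CCC DCC /andP[x0 x1] u v.
rewrite /flow_measure !val_flow_shift // !(shiftAC _ _ t).
rewrite /mu_flow !mulf_div mulrA ler_wpM2r //.
  by rewrite invr_ge0 -expr2 sqr_ge0.
rewrite -exprM -!exprD ler_wiXn2l ?(ltW x0) // muln2.
by apply: supp_shift_exchange => e eD; rewrite !shift_notin.
Qed.

Lemma markov_op_flow_chain x h :
  markov_op (chain x) h =1 heat_bath CC flow_shift (flow_measure x) h.
Proof.
move=> f; rewrite /markov_op /flow_chain.
under eq_bigr do rewrite -mulrA mulr_suml.
rewrite -mulr_sumr exchange_big /=; congr (_ * _); apply: eq_bigr => C CCC.
rewrite /resample /weighted_mean.
under [in RHS]eq_bigr do rewrite /flow_measure val_flow_shift //.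
under [X in _ = _ / X]eq_bigr do rewrite /flow_measure val_flow_shift //.
under eq_bigr do rewrite mulr_suml big_mkcond.
rewrite exchange_big mulr_suml; apply: eq_bigr => t _ /=.
rewrite -big_mkcond (big_pred1 (flow_shift C t f)) => [|g].
  by rewrite mulrAC.
by rewrite -val_flow_shift //= eq_sym.
Qed.

Lemma flow_chain_stationary x :
  0 < x -> (0 < #|CC|)%N -> stationary (chain x) (flow_measure x).
Proof.
move=> x0 CC0 h; under eq_bigr do rewrite markov_op_flow_chain.
apply: sum_heat_bath => //; [exact: flow_shift0 | exact: flow_shiftD |].
by move=> f; apply: flow_measure_gt0.
Qed.

Lemma flow_path_of_sum (c : {set edge G} -> 'Z_q) (s : seq {set edge G}) f g :
  {subset s <= CC} ->
  (forall e, val g e = val f e + \sum_(C <- s) c C * (chi C (o C) e)%:~R) ->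
  exists p, [/\ path (adjacent CC flow_shift) f p, last f p = g
              & (size p <= size s)%N].
Proof.
elim: s f => [|C s IHs] f sCC gE.
  exists [::]; split=> //; apply/val_inj/ffunP => e.
  by rewrite gE big_nil addr0.
have CCC : C \in CC by apply: sCC; rewrite mem_head.
have [||p [path_p last_p size_p]] := IHs (flow_shift C (c C) f).
- by move=> D Ds; apply: sCC; rewrite inE Ds orbT.
- by move=> e; rewrite val_flow_shift // ffunE gE big_cons addrA.
by exists (flow_shift C (c C) f :: p); rewrite /= adjacent_move.
Qed.

Lemma flow_diameter : diameter_le (adjacent CC flow_shift) #|CC|.
Proof.
move=> f g; have [_ genP] := gen.
have [/genP[cf fE] /genP[cg gE]] := (valP f, valP g).
rewrite cardE; apply: (flow_path_of_sum (c := fun C => cg C - cf C)) => [C|e].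
  by rewrite mem_enum.
rewrite big_enum /=; under [X in _ + X]eq_bigr do rewrite mulrBl.
by rewrite sumrB -fE -gE addrC subrK.
Qed.

Lemma flow_chain_contraction x d io s :
  0 < x <= 1 -> (gs_degree CC <= d)%N -> (gs_inter CC <= io)%N ->
  d%:R * birkhoff_coef (x ^+ io) <= s ->
  lipschitz_contraction (adjacent CC flow_shift) (1 - (1 - s) / #|CC|%:R)
    (chain x).
Proof.
move=> x01 hdeg hinter hs L h L0 hL; have /andP[x0 x1] := x01.
apply: eq_lipschitz (fun f => esym (markov_op_flow_chain x h f)) _.
apply: (heat_bath_lipschitz flow_shiftD flow_shiftC
  (fun f => flow_measure_gt0 f x0)
  (c := fun C D => x ^+ #|C :&: D|)) => // [C D|C D t f CCC DCC _|C CCC].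
- by rewrite exprn_ge0 ?exprn_ile1 // ltW.
- exact: flow_measure_cross_ratio.
- exact: le_trans (sum_birkhoff_coef_le x01 hdeg hinter CCC) hs.
Qed.

Lemma flow_chain_mixing_time_le x delta d io s :
  0 < x <= 1 -> (gs_degree CC <= d)%N -> (gs_inter CC <= io)%N ->
  d%:R * birkhoff_coef (x ^+ io) <= s < 1 ->
  (0 < #|CC|)%N -> 0 < delta <= #|CC|%:R ->
  exists2 n, flow_mixing_time q o CC x delta n &
    n%:R <= Num.max 1 (mixing_steps ((1 - s) / #|CC|%:R) #|CC|%:R delta).
Proof.
move=> x01 hdeg hinter /andP[coef_s s1] CC0 hdelta; have /andP[x0 x1] := x01.
have s0 : 0 <= s.
  rewrite (le_trans _ coef_s) // mulr_ge0 // birkhoff_coef_ge0 //.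
  by rewrite exprn_ge0 ?exprn_ile1 // ltW.
have r1 : 1 <= #|CC|%:R :> R by rewrite ler1n.
have b01 : 0 < (1 - s) / #|CC|%:R <= 1.
  by rewrite divr_gt0 ?subr_gt0 ?ltr0n // ler_pdivrMr ?ltr0n //; lra.
apply: mixing_time_le => // n f; apply: path_coupling flow_diameter _ _ _.
- by rewrite subr_ge0; case/andP: b01.
- exact: flow_chain_contraction coef_s.
- exact: flow_measure_distribution.
- exact: flow_chain_stationary.
Qed.

(* If [CC] is empty then [flow_chain] is identically [0], because [0^-1 = 0],
   and not a stochastic kernel; but then there is only one flow. *)
Lemma flow_chain_mixed0 x delta :
  0 < x -> 0 < delta -> (#|CC| == 0)%N || (1 <= delta) ->
  mixed (chain x) (flow_measure x) delta 0.
Proof.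
move=> x0 delta0 small f; have mu1 := flow_measure_distribution G q x0.
have start1 := nstep0_distribution (chain x) f.
case/orP: small => [/eqP CC0|]; last exact: le_trans (tv_dist_le1 start1 mu1).
rewrite tv_dist_subsingleton // => [|g k]; first exact: ltW.
by have [p []] := flow_diameter g k; rewrite CC0 leqn0 => _ <- /nilP ->.
Qed.

Lemma flow_chain_mixing_time_le_bound x xi delta d io :
  (0 < d)%N -> (0 < io)%N -> xi = x - (1 - 2 / ((d%:R + 1) * io%:R)) ->
  0 < xi -> 0 < x <= 1 -> (gs_degree CC <= d)%N -> (gs_inter CC <= io)%N ->
  (0 < #|CC|)%N -> 0 < delta < 1 ->
  let B := mixing_bound d%:R io%:R #|CC|%:R delta xi in
  exists n, [/\ flow_mixing_time q o CC x delta n,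
                2 * delta <= #|CC|%:R -> n%:R <= B & n%:R <= Num.max 1 B].
Proof.
rewrite -(ltr0n R d) -(ltr0n R io).
move=> d0 io0 xiE xi0 x01 hdeg hinter CC0 delta01.
have r1 : 1 <= #|CC|%:R :> R by rewrite ler1n.
have delta_r : 0 < delta <= #|CC|%:R by lra.
have /andP[_ x1] := x01; have /andP[delta0 _] := delta01.
have s0 := dobrushin_bound_ge0 (ltW d0) (ltW io0) x1.
have s1 : dobrushin_bound d%:R io%:R x < 1.
  by rewrite dobrushin_bound_lt1 // -subr_gt0 -xiE.
have coef_s :
    d%:R * birkhoff_coef (x ^+ io) <= dobrushin_bound d%:R io%:R x < 1.
  by rewrite s1 birkhoff_coef_expn_le ?(ltW s1) ?(ltW d0).
have [n mix_n n_le] :=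
  flow_chain_mixing_time_le x01 hdeg hinter coef_s CC0 delta_r.
have := mixing_steps_le_bound d0 io0 xi0 delta_r.
rewrite xiE -dobrushin_bound_gap // -xiE => steps_le.
exists n; split=> // [two_delta|]; apply: le_trans n_le _.
  rewrite ge_max steps_le andbT (le_trans _ steps_le) // mixing_steps_ge1 //.
  by rewrite divr_gt0 ?ler_pdivrMr ?subr_gt0 //; lra.
by rewrite ge_max !le_max lexx steps_le orbT.
Qed.

End FlowChain.

Theorem theorem3p2 (R : realType) (q d io : nat) (x xi delta : R)
    (hq : (2 <= q)%N) (hd : (2 <= d)%N) (hio : (1 <= io)%N)
    (hx1 : x < 1) (hx : 1 - 2 / ((d%:R + 1) * io%:R) < x)
    (hxi : xi = x - (1 - 2 / ((d%:R + 1) * io%:R)))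
    (hdelta : 0 < delta)
    (G : multigraph) (o : {set edge G} -> edge G -> bool)
    (CC : {set {set edge G}}) (r : nat)
    (ho : forall C, C \in CC -> eulerian_orientation C (o C))
    (hCC : even_generating_set q o CC)
    (hr : #|CC| = r)
    (hdeg : (gs_degree CC <= d)%N) (hinter : (gs_inter CC <= io)%N) :
  exists tmix : nat,
    [/\ flow_mixing_time q o CC x delta tmix,
        delta <= r%:R -> (2 <= r)%N \/ delta <= 1 / 2 ->
          tmix%:R <= 4 * r%:R / (d%:R * io%:R) * ln (r%:R * delta^-1) * xi^-1
      & tmix%:R <=
          Num.max 1 (4 * r%:R / (d%:R * io%:R) * ln (r%:R * delta^-1) * xi^-1)].
Proof.
have dR : 2 <= d%:R :> R by rewrite ler_nat.
have ioR : 1 <= io%:R :> R by rewrite ler1n.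
have xi0 : 0 < xi by rewrite hxi subr_gt0.
have x0 : 0 < x.
  by apply: le_lt_trans hx; rewrite subr_ge0 ler_pdivrMr; nra.
rewrite -/(mixing_bound d%:R io%:R r%:R delta xi) -hr.
have [small|] := boolP ((#|CC| == 0)%N || (1 <= delta)).
  exists 0%N; split; last by rewrite le_max ler01.
    by split=> // f; exact: (flow_chain_mixed0 hCC x0 hdelta small).
  by move=> delta_r _; apply: mixing_bound_ge0; rewrite ?hdelta //; lra.
rewrite negb_or -lt0n -ltNge => /andP[CC0 delta1].
have [x01 delta01] : 0 < x <= 1 /\ 0 < delta < 1 by lra.
have [t [mix_t t_le t_le_max]] := flow_chain_mixing_time_le_bound
  hCC (ltnW hd) hio hxi xi0 x01 hdeg hinter CC0 delta01.
exists t; split=> // _ r2; apply: t_le.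
move: CC0; rewrite -(ler1n R); case: r2 => [|]; [rewrite -(ler_nat R)|]; lra.
Qed.
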